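(* Let $(M,d)$ be a complete $\omega$-homogeneous Urysohn metric space, let $G=\mathrm{Iso}(M)$, let $\Theta$ be the compact space of all bi-Katětov functions on $M^2$ (with the topology of pointwise convergence), and let $i:G\to\Theta$ be the embedding given by $i(\varphi)(x,y)=d(x,\varphi(y))$. Then the range of $i$ is dense in $\Theta$, and the uniformity on $G$ induced by $i$ (the coarsest uniformity on $G$ making $i$ uniformly continuous, where $\Theta$ carries its unique compatible uniformity) coincides with the Roelcke uniformity $\mathcal L\wedge\mathcal R$ of $G$. Therefore $G$ is Roelcke-precompact, and the Roelcke compactification of $G$ can be identified with $\Theta$ (via $i$).
   Context: For a metric space $M$, $\mathrm{Iso}(M)$ denotes the topological group of all isometries of $M$ onto itself with the topology of pointwise convergence. $M$ is $\omega$-homogeneous if every isometry between finite subsets of $M$ extends to an isometry of $M$ onto itself. $M$ is Urysohn if its diameter equals $1$ and for every finite metric space $L$ of diameter $\le1$, every $K\subset L$ and every isometric embedding $f:K\to M$, $f$ extends to an isometric embedding of $L$ into $M$. A function $f:M\times M\to[0,1]$ is bi-Katětov if for all $x,y,z\in M$: $|f(x,y)-f(x,z)|\le d(y,z)\le f(x,y)+f(x,z)$ and $|f(y,x)-f(z,x)|\le d(y,z)\le f(y,x)+f(z,x)$. For a topological group $G$, $\mathcal L$ and $\mathcal R$ are the left and right uniformities (basic entourages $\{(x,y):x^{-1}y\in U\}$, resp. $\{(x,y):yx^{-1}\in U\}$, $U$ a neighbourhood of the unity). The Roelcke uniformity $\mathcal L\wedge\mathcal R$ is their greatest lower bound; the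 covers $\{UxU:x\in G\}$, $U$ a neighbourhood of the unity, form a base of its uniform covers. $G$ is Roelcke-precompact if it is precompact with respect to $\mathcal L\wedge\mathcal R$; in that case the completion of $G$ with respect to $\mathcal L\wedge\mathcal R$ is compact and is called the Roelcke compactification of $G$. *)

(* Defs.v *)
From HB Require Import structures.
From mathcomp Require Import all_boot all_order all_algebra lra.
From mathcomp Require Import all_classical all_reals all_analysis.

Set Implicit Arguments.
Unset Strict Implicit.
Unset Printing Implicit Defensive.

Import Order.TTheory GRing.Theory Num.Theory.
Import numFieldTopology.Exports.

Local Open Scope classical_set_scope.
Local Open Scope ring_scope.

(* The library's [completeType] and [cvg] live on pointed types; this is the
   same condition without a base point. *)
Definition complete_space (T : uniformType) : Prop :=
  forall F : set_system T, ProperFilter F -> cauchy F -> exists l : T, F --> l.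

Definition precompact_space (T : uniformType) : Prop :=
  forall E : set (T * T), entourage E ->
    exists2 F : set T, finite_set F & forall y, exists2 x, F x & E (x, y).

(* [(Y, j)] is a (Hausdorff) completion of [X].  The entourages of
   [initial_topology j] form the coarsest uniformity on [X] making [j]
   uniformly continuous. *)
Definition is_completion (X Y : uniformType) (j : X -> Y) : Prop :=
  [/\ complete_space Y, hausdorff_space Y, dense (range j) &
      @entourage (initial_topology j) = @entourage X].

Definition unif_isomorphism (X Y : uniformType) (h : X -> Y) : Prop :=
  exists k : Y -> X,
    [/\ cancel h k, cancel k h, unif_continuous h & unif_continuous k].

Section meet_uniformity.
Local Open Scope relation_scope.
Context {T : Type}.
Implicit Types E : set_system (T * T).

Definition is_uniformity E : Prop :=
  [/\ Filter E,
      forall A, E A -> diagonal `<=` A,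
      forall A, E A -> E A^-1 &
      forall A, E A -> exists2 B, E B & B \; B `<=` A].

(* Greatest lower bound in the lattice of uniformities on [T]: the union of all
   the uniformities coarser than both [E1] and [E2] is again one of them. *)
Definition meet_uniformity E1 E2 : set_system (T * T) :=
  [set A | exists E, [/\ is_uniformity E, E `<=` E1, E `<=` E2 & E A]].

Lemma is_uniformity_meet E1 E2 : Filter E1 -> Filter E2 ->
  (forall A, E1 A -> diagonal `<=` A) -> is_uniformity (meet_uniformity E1 E2).
Proof.
move=> F1 F2 diag1.
have join (E E' : set_system (T * T)) : is_uniformity E -> is_uniformity E' ->
    is_uniformity (filter_from (fun AB => E AB.1 /\ E' AB.2)
                               (fun AB => AB.1 `&` AB.2)).
  move=> [FE dE iE sE] [FE' dE' iE' sE']; split.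
  - apply: filter_from_filter; first by exists (setT, setT); split; exact: filterT.
    move=> [A B] [C D] /= [EA EB] [EC ED].
    exists (A `&` C, B `&` D) => /=; first by split; exact: filterI.
    by move=> x [[? ?] [? ?]].
  - by move=> A [[B C] /= [EB EC] BCA] x dx; apply: BCA; split; [exact: dE dx|exact: dE' dx].
  - move=> A [[B C] /= [EB EC] BCA]; exists (B^-1, C^-1) => /=.
      by split; [exact: iE|exact: iE'].
    by move=> [x y] [Bx Cx]; apply: BCA.
  - move=> A [[B C] /= [EB EC] BCA].
    have [B' EB' B'B] := sE _ EB; have [C' EC' C'C] := sE' _ EC.
    exists (B' `&` C'); first by exists (B', C').
    move=> x [z [B1 C1] [B2 C2]]; apply: BCA.
    by split; [apply: B'B|apply: C'C]; exists z.
have triv : is_uniformity [set A : set (T * T) | A = setT].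
  split.
  - split=> //; first by move=> P Q /= -> ->; rewrite setIT.
    by move=> P Q PQ /= PT; apply/seteqP; split=> // x _; apply: PQ; rewrite PT.
  - by move=> A ->.
  - by move=> A ->; apply/seteqP; split.
  - by move=> A ->; exists setT.
split.
- split.
  + by exists [set A | A = setT]; split=> // A ->; exact: filterT.
  + move=> A B [E [uE E1E E2E EA]] [E' [uE' E1E' E2E' EB]].
    exists (filter_from (fun AB => E AB.1 /\ E' AB.2) (fun AB => AB.1 `&` AB.2)).
    split; first exact: join.
    * move=> C [[D D'] /= [ED ED'] /filterS]; apply.
      by apply: filterI; [exact: E1E|exact: E1E'].
    * move=> C [[D D'] /= [ED ED'] /filterS]; apply.
      by apply: filterI; [exact: E2E|exact: E2E'].
    * by exists (A, B).
  + move=> A B AB [E [uE E1E E2E EA]]; exists E; split=> //.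
    by case: uE => FE _ _ _; exact: filterS AB EA.
- by move=> A [E [_ E1E _ /E1E/diag1]].
- move=> A [E [uE E1E E2E EA]]; exists E; split=> //.
  by case: uE => _ _ iE _; exact: iE.
- move=> A [E [uE E1E E2E EA]]; have [_ _ _ /(_ _ EA)[B EB BA]] := uE.
  by exists B => //; exists E.
Qed.

Lemma meet_uniformity_greatest E1 E2 :
  [/\ meet_uniformity E1 E2 `<=` E1, meet_uniformity E1 E2 `<=` E2 &
      forall E, is_uniformity E -> E `<=` E1 -> E `<=` E2 ->
        E `<=` meet_uniformity E1 E2].
Proof.
split=> [A [E [_ + _]]|A [E [_ _ +]]|]; [exact|exact|].
by move=> E uE EE1 EE2 A EA; exists E.
Qed.

End meet_uniformity.

HB.mixin Record Group_isTopologicalGroup G of Topological G & Group G := {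
  mulg_continuous : continuous (fun p : G * G => (p.1 * p.2)%g);
  invg_continuous : continuous (fun x : G => (x^-1)%g)
}.

#[short(type="topologicalGroupType")]
HB.structure Definition TopologicalGroup :=
  {G of Topological G & Group G & Group_isTopologicalGroup G}.

Section roelcke.
Variable G : topologicalGroupType.

Definition left_uniformity : set_system (G * G) :=
  filter_from (nbhs (1%g : G)) (fun U => [set p | U (p.1^-1 * p.2)%g]).

Definition right_uniformity : set_system (G * G) :=
  filter_from (nbhs (1%g : G)) (fun U => [set p | U (p.2 * p.1^-1)%g]).

Definition roelcke_uniformity : set_system (G * G) :=
  meet_uniformity left_uniformity right_uniformity.

Lemma left_uniformity_filter : Filter left_uniformity.
Proof.
apply: filter_from_filter; first by exists setT; exact: filterT.
by move=> U V nU nV; exists (U `&` V) => //; exact: filterI.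
Qed.

Lemma right_uniformity_filter : Filter right_uniformity.
Proof.
apply: filter_from_filter; first by exists setT; exact: filterT.
by move=> U V nU nV; exists (U `&` V) => //; exact: filterI.
Qed.

Lemma left_uniformity_diagonal A : left_uniformity A -> diagonal `<=` A.
Proof.
move=> [U nU UA] [x y] /diagonalP ->; apply: UA => /=.
by rewrite mulVg; exact: nbhs_singleton.
Qed.

Lemma is_uniformity_roelcke : is_uniformity roelcke_uniformity.
Proof.
apply: is_uniformity_meet; [exact: left_uniformity_filter|
  exact: right_uniformity_filter|exact: left_uniformity_diagonal].
Qed.

Definition roelcke : Type := G.

HB.instance Definition _ := Choice.on roelcke.
HB.instance Definition _ := @isUniform.Build roelcke roelcke_uniformity
  (let: And4 h _ _ _ := is_uniformity_roelcke in h)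
  (let: And4 _ h _ _ := is_uniformity_roelcke in h)
  (let: And4 _ _ h _ := is_uniformity_roelcke in h)
  (let: And4 _ _ _ h := is_uniformity_roelcke in h).

Definition roelcke_precompact : Prop := precompact_space roelcke.

Definition roelcke_compactification (K : uniformType) (j : roelcke -> K) : Prop :=
  roelcke_precompact /\ is_completion j.

End roelcke.

Arguments left_uniformity G : clear implicits.
Arguments right_uniformity G : clear implicits.
Arguments roelcke_uniformity G : clear implicits.

Section metric.
Context {R : realType}.

Definition isometric_on (X Y : metricType R) (A : set X) (f : X -> Y) : Prop :=
  {in A &, forall x y, mdist (f x) (f y) = mdist x y}.

Definition diameter (X : metricType R) : \bar R :=
  ereal_sup [set (mdist p.1 p.2)%:E | p in [set: X * X]].

End metric.

Section isometry_group.
Context {R : realType}.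
Variable M : metricType R.

Definition isometries : set {ptws M -> M} :=
  [set phi | isometric_on setT phi /\ range phi = setT].

Definition Iso : Type := isometries.

Definition iso_fun (phi : Iso) : M -> M := \val phi.

Coercion iso_fun : Iso >-> Funclass.

HB.instance Definition _ := Choice.on Iso.
(* The topology of pointwise convergence, as a subspace of [{ptws M -> M}]. *)
HB.instance Definition _ :=
  Topological.copy Iso (set_type isometries : topologicalType).

Lemma iso_dist (phi : Iso) x y : mdist (phi x) (phi y) = mdist x y.
Proof. by have /set_mem[+ _] := valP phi; apply; rewrite in_setT. Qed.

Lemma iso_surj (phi : Iso) y : exists x, phi x = y.
Proof.
have /set_mem[_ phiT] := valP phi.
have : [set: M] y by [].
by rewrite -phiT => -[x _ <-]; exists x.
Qed.

Lemma iso_inj (phi : Iso) : injective phi.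
Proof.
by move=> x y xy; apply: mdist_positivity; rewrite -(iso_dist phi) xy mdistxx.
Qed.

Lemma iso_eq (phi psi : Iso) : phi =1 psi -> phi = psi.
Proof. by move=> e; apply/val_inj/funext. Qed.

Lemma isometriesP (f : M -> M) : (forall x y, mdist (f x) (f y) = mdist x y) ->
  (forall y, exists x, f x = y) -> f \in isometries.
Proof.
move=> fd fs; apply/mem_set; split; first by move=> x y _ _; exact: fd.
by apply/seteqP; split=> // y _; have [x <-] := fs y; exists x.
Qed.

Definition mk_iso (f : M -> M) (fd : forall x y, mdist (f x) (f y) = mdist x y)
  (fs : forall y, exists x, f x = y) : Iso := SigSub (isometriesP fd fs).

Definition iso_one : Iso :=
  mk_iso (f := id) (fun _ _ => erefl) (fun y => ex_intro _ y erefl).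

Lemma iso_mul_dist (phi psi : Iso) x y :
  mdist (phi (psi x)) (phi (psi y)) = mdist x y.
Proof. by rewrite !iso_dist. Qed.

Lemma iso_mul_surj (phi psi : Iso) y : exists x, phi (psi x) = y.
Proof.
by have [z <-] := iso_surj phi y; have [x <-] := iso_surj psi z; exists x.
Qed.

Definition iso_mul (phi psi : Iso) : Iso :=
  mk_iso (f := fun x => phi (psi x)) (iso_mul_dist phi psi) (iso_mul_surj phi psi).

Definition iso_inv_fun (phi : Iso) (y : M) : M := projT1 (cid (iso_surj phi y)).

Lemma iso_inv_funK (phi : Iso) : cancel (iso_inv_fun phi) phi.
Proof. by move=> y; exact: (projT2 (cid (iso_surj phi y))). Qed.

Lemma iso_funK (phi : Iso) : cancel phi (iso_inv_fun phi).
Proof. by move=> y; apply: (@iso_inj phi); rewrite iso_inv_funK. Qed.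

Lemma iso_inv_dist (phi : Iso) x y :
  mdist (iso_inv_fun phi x) (iso_inv_fun phi y) = mdist x y.
Proof. by rewrite -(iso_dist phi) !iso_inv_funK. Qed.

Lemma iso_inv_surj (phi : Iso) y : exists x, iso_inv_fun phi x = y.
Proof. by exists (phi y); exact: iso_funK. Qed.

Definition iso_inv (phi : Iso) : Iso :=
  mk_iso (iso_inv_dist phi) (iso_inv_surj phi).

Lemma iso_mulA : associative iso_mul.
Proof. by move=> phi psi chi; apply: iso_eq. Qed.

Lemma iso_mul1 : left_id iso_one iso_mul.
Proof. by move=> phi; apply: iso_eq. Qed.

Lemma iso_mulr1 : right_id iso_one iso_mul.
Proof. by move=> phi; apply: iso_eq. Qed.

Lemma iso_mulV : left_inverse iso_one iso_inv iso_mul.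
Proof. by move=> phi; apply: iso_eq => x; exact: iso_funK. Qed.

Lemma iso_mulrV : right_inverse iso_one iso_inv iso_mul.
Proof. by move=> phi; apply: iso_eq => x; exact: iso_inv_funK. Qed.

HB.instance Definition _ :=
  isGroup.Build Iso iso_mulA iso_mul1 iso_mulr1 iso_mulV iso_mulrV.

Lemma cvg_iso (F : set_system Iso) (phi : Iso) : Filter F ->
  F --> phi <->
  forall x (e : R), 0 < e -> F [set psi : Iso | mdist (phi x) (psi x) < e].
Proof.
move=> FF; split=> [Fphi x e e0|Fphi].
  have ev : continuous (fun psi : Iso => psi x : M).
    move=> psi; apply: (@continuous_comp _ _ _
      (val : initial_topology (val : Iso -> {ptws M -> M}) -> {ptws M -> M})
      (fun f : {ptws M -> M} => f x)); first exact: initial_continuous.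
    exact: (@proj_continuous _ (fun=> M) x).
  have := cvg_comp _ _ Fphi (ev phi); move/(_ _ (nbhsx_ballx (phi x) e e0)).
  by rewrite ballEmdist.
move=> A [_ [[B oB <-] Bphi] /= BA].
apply: filterS BA _.
have : (\val @ F : set_system {ptws M -> M}) --> (\val phi : {ptws M -> M}).
  apply/cvg_sup => x U [_ [[C oC <-] Cphi] /= CU].
  apply: filterS CU _.
  have /nbhs_ballP[e e0 eC] : nbhs (phi x) C by apply: open_nbhs_nbhs.
  rewrite nbhs_filterE /=; apply: filterS (Fphi x e e0) => psi phipsi.
  by apply: eC; rewrite ballEmdist.
by apply; apply: open_nbhs_nbhs.
Qed.

Let iso_mul_continuous : continuous (fun p : Iso * Iso => (p.1 * p.2)%g).
Proof.
move=> [phi psi]; apply/cvg_iso => x e e0.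
have e20 : 0 < e / 2 by rewrite divr_gt0.
have /cvg_iso/(_ x _ e20) Npsi : nbhs psi --> psi by [].
have /cvg_iso/(_ (iso_fun psi x) _ e20) Nphi : nbhs phi --> phi by [].
exists ([set p : Iso | mdist (iso_fun phi (iso_fun psi x)) (p (iso_fun psi x)) < e / 2],
        [set p : Iso | mdist (iso_fun psi x) (p x) < e / 2]) => //.
move=> [p q] [/= pP qP]; rewrite (splitr e).
apply: le_lt_trans (metric_triangle _ (iso_fun p (iso_fun psi x)) _) _.
by apply: ltrD => //; rewrite iso_dist.
Qed.

Let iso_inv_continuous : continuous (fun phi : Iso => (phi^-1)%g).
Proof.
move=> phi; have FF : Filter ((fun psi : Iso => (psi^-1)%g) @ nbhs phi).
  exact: fmap_filter.
apply/(cvg_iso _ FF) => y e e0.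
have [x <-] := iso_surj phi y.
have /cvg_iso/(_ x _ e0) : nbhs phi --> phi by [].
rewrite nbhs_filterE; apply: filterS => psi /= phipsi.
rewrite /iso_fun /= iso_funK -(iso_dist psi) iso_inv_funK.
by rewrite metric_sym.
Qed.

HB.instance Definition _ :=
  Group_isTopologicalGroup.Build Iso iso_mul_continuous iso_inv_continuous.

End isometry_group.

Section urysohn.
Context {R : realType}.
Variable M : metricType R.

Definition omega_homogeneous : Prop :=
  forall (A B : set M) (f : M -> M), finite_set A -> finite_set B ->
    isometric_on A f -> f @` A = B ->
    exists phi : Iso M, {in A, phi =1 f}.

(* A partial map [K -> M] is given by a total map restricted to [K]; nothing is
   lost when [K] is empty, since [diameter M = 1] forces [M] to be inhabited. *)
Definition urysohn : Prop :=
  diameter M = 1%E /\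
  forall (L : metricType R) (K : set L) (f : L -> M),
    finite_set [set: L] -> (diameter L <= 1)%E -> isometric_on K f ->
    exists2 g : L -> M, isometric_on setT g & {in K, g =1 f}.

Definition bi_katetov : set {ptws M * M -> R} :=
  [set f | (forall x y, 0 <= f (x, y) <= 1) /\
    forall x y z,
      `|f (x, y) - f (x, z)| <= mdist y z <= f (x, y) + f (x, z) /\
      `|f (y, x) - f (z, x)| <= mdist y z <= f (y, x) + f (z, x)].

(* As a set type over [{ptws M * M -> R}], [Theta] carries the topology of
   pointwise convergence and the uniformity of pointwise convergence, which
   induces that topology. *)
Definition Theta : Type := bi_katetov.

HB.instance Definition _ := Choice.on Theta.
HB.instance Definition _ :=
  Uniform.copy Theta (set_type bi_katetov : uniformType).

Lemma urysohn_diameter : urysohn -> diameter M = 1%E.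
Proof. by case. Qed.

Context (diamM : diameter M = 1%E).

Lemma mdist_le1 (x y : M) : mdist x y <= 1.
Proof.
by rewrite -lee_fin -diamM; apply: ereal_sup_ubound; exists (x, y).
Qed.

Lemma bi_katetov_iso (phi : Iso M) :
  (fun p : M * M => mdist p.1 (phi p.2)) \in bi_katetov.
Proof.
have dist3 (a b c : M) :
    `|mdist a b - mdist a c| <= mdist b c <= mdist a b + mdist a c.
  have abc := metric_triangle a b c; have acb := metric_triangle a c b.
  have bac := metric_triangle b a c; rewrite (metric_sym b a) in bac.
  by rewrite (metric_sym c b) in acb; rewrite bac ler_norml; lra.
apply/mem_set; split => [x y|x y z] /=; first by rewrite mdist_ge0 mdist_le1.
split; first by rewrite -(iso_dist phi y z); exact: dist3.
by rewrite (metric_sym y _) (metric_sym z (phi x)); exact: dist3.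
Qed.

Definition iso_to_Theta (phi : Iso M) : Theta := SigSub (bi_katetov_iso phi).

Lemma iso_to_Theta_inj : injective iso_to_Theta.
Proof.
move=> phi psi /(congr1 val) e; apply: iso_eq => y; apply: mdist_positivity.
by have /= <- := congr1 (fun f => f (phi y, y)) e; rewrite mdistxx.
Qed.

Lemma iso_to_Theta_embedding (F : set_system (Iso M)) (phi : Iso M) :
  Filter F -> F --> phi <-> iso_to_Theta @ F --> iso_to_Theta phi.
Proof.
move=> FF; split=> [/(cvg_iso _ FF) Fphi|Fphi].
  move=> A [_ [[B oB <-] Bphi] /= BA].
  rewrite nbhs_filterE /=; apply: (@filterS _ F _ (fun psi => B (\val (iso_to_Theta psi)))).
    by move=> psi; exact: BA.
  have : ((\val \o iso_to_Theta) @ F : set_system {ptws M * M -> R}) -->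
      (\val (iso_to_Theta phi) : {ptws M * M -> R}).
    apply/cvg_sup => -[x y] U [_ [[C oC <-] Cphi] /= CU].
    apply: filterS CU _.
    have /nbhs_ballP[e e0 eC] : nbhs (mdist x (phi y)) C by apply: open_nbhs_nbhs.
    rewrite nbhs_filterE /=; apply: filterS (Fphi y e e0) => psi phipsi.
    apply: eC; rewrite /ball/=; apply: le_lt_trans phipsi.
    have a := metric_triangle x (psi y) (phi y).
    have b := metric_triangle x (phi y) (psi y).
    rewrite (metric_sym (psi y)) in a.
    by rewrite ler_norml; lra.
  by apply; apply: open_nbhs_nbhs.
apply/(cvg_iso _ FF) => x e e0.
have ev : continuous (fun f : Theta => \val f (phi x, x) : R).
  move=> f; apply: (@continuous_comp _ _ _
    (val : initial_topology (val : Theta -> {ptws M * M -> R}) -> _)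
    (fun g : {ptws M * M -> R} => g (phi x, x))); first exact: initial_continuous.
  exact: (@proj_continuous _ (fun=> R) (phi x, x)).
have := cvg_comp _ _ Fphi (ev (iso_to_Theta phi)).
move/(_ _ (nbhsx_ballx _ e e0)).
rewrite nbhs_filterE /=; apply: filterS => psi /=.
by rewrite /ball/= mdistxx sub0r normrN ger0_norm ?mdist_ge0.
Qed.

End urysohn.

(* Main.v *)
(** A bi-Katetov function restricted to a finite set [s] prescribes distances
    from [s] to a second copy of [s]; the Urysohn property realizes them in [M]
    over the first copy, and homogeneity turns the realization into an isometry,
    so the range of [i] is dense.

    [i] is uniformly continuous for both the left and the right uniformity.
    Conversely, let [i phi] and [i psi] be close on a finite set [s].  Then the
    configurations [s, phi s] and [s, psi s] have almost equal distances, so both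
    embed in one finite metric space with corresponding points close together,
    and some isometry [w] almost fixes [s] and almost maps [psi s] to [phi s].
    Thus [phi] is left-close to [w psi], which is right-close to [psi], and the
    chain [phi, w psi, psi] witnesses Roelcke closeness.

    Compactness of [Theta] (Tychonoff) yields precompactness and completeness;
    uniqueness of the completion is extension of uniformly continuous maps. *)
Require Import Defs.
From HB Require Import structures.
From mathcomp Require Import all_boot all_order all_algebra lra.
From mathcomp Require Import all_classical all_reals all_analysis.

Set Implicit Arguments.
Unset Strict Implicit.
Unset Printing Implicit Defensive.

Import Order.TTheory GRing.Theory Num.Theory.
Import numFieldTopology.Exports.

Local Open Scope classical_set_scope.
Local Open Scope ring_scope.

(** * Density, compactness and completeness in uniform spaces *)

Lemma dense_nbhs (T : topologicalType) (S A : set T) (y : T) :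
  dense S -> nbhs y A -> A `&` S !=set0.
Proof.
move=> dS; rewrite nbhsE => -[B [oB By] BA].
have [|z [Bz Sz]] := dS B _ oB; first by exists y.
by exists z; split=> //; exact: BA.
Qed.

Lemma dense_entourage (T : uniformType) (S : set T) (E : set (T * T)) (y : T) :
  dense S -> entourage E -> exists2 x, S x & E (y, x).
Proof.
move=> dS entE.
have [x [/xsectionP Ex Sx]] := dense_nbhs dS (nbhs_entourage y entE).
by exists x.
Qed.

Lemma unif_continuous_continuous (T U : uniformType) (f : T -> U) :
  unif_continuous f -> continuous f.
Proof.
move=> uf x; apply/cvg_app_entourageP => E /uf entE.
have /cvg_entourageP/(_ _ entE) : x @[x --> x] --> x by [].
exact: filterS.
Qed.

Lemma continuous_dense_eq (T U : topologicalType) (S : set T) (f g : T -> U) :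
  hausdorff_space U -> dense S -> continuous f -> continuous g ->
  {in S, f =1 g} -> f =1 g.
Proof.
move=> hU dS cf cg fg y; apply: hU => A B nA nB.
have nC : nbhs y (f @^-1` A `&` g @^-1` B).
  by apply: filterI; [exact: cf|exact: cg].
have [z [[Az Bz] Sz]] := dense_nbhs dS nC.
by exists (f z); split=> //; rewrite fg ?inE.
Qed.

Lemma compact_complete_space (T : uniformType) :
  compact [set: T] -> complete_space T.
Proof.
move=> cT F PF cF; have [x [_ clx]] := cT F PF filterT.
exists x; apply/cvg_entourageP => E entE.
have [[A B] [/= FA FB] ABE] := cF _ (entourage_split_ent entE).
have nx := nbhs_entourage x (entourage_split_ent entE).
have [z [Az /xsectionP xz]] := clx _ _ FA nx.
apply: filterS FB => t Bt; apply: (entourage_split z) => //.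
exact: (ABE (z, t)).
Qed.

(** Each point of [Y] has a neighbourhood served by a single [j x]. Near-covering compactness, with
    the finite subsets of [X] directed by inclusion as parameter, yields one finite set for all
    points. *)
Lemma compact_precompact_space (X Y : uniformType) (j : X -> Y) :
  compact [set: Y] -> dense (range j) ->
  @entourage (initial_topology j) = @entourage X -> precompact_space X.
Proof.
move=> /compact_near_coveringP cY dj eX E; rewrite -eX => -[V entV VE].
pose F : set_system (set X) :=
  filter_from (@finite_set X) (fun A => [set B | finite_set B /\ A `<=` B]).
have FF : Filter F.
  apply: filter_from_filter; first by exists set0; exact: finite_set0.
  move=> A B fA fB; exists (A `|` B); first by rewrite finite_setU.
  by move=> C /= [fC]; rewrite subUset => -[AC BC].
have : \near F, [set: Y] `<=` (fun y => exists2 x, F x & V (j x, y)).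
  apply: cY => y _.
  have entV' := entourage_invI (entourage_split_ent entV).
  have [_ [x _ <-] [_ /= yx]] := dense_entourage y dj entV'.
  exists (xsection (split_ent V) y, [set B | finite_set B /\ [set x] `<=` B]).
    split; first by apply: nbhs_entourage; exact: entourage_split_ent.
    by exists [set x].
  move=> [y' B] [/= /xsectionP yy' [_ xB]]; exists x; first exact: xB.
  exact: (entourage_split y).
move=> [A fA /(_ A) AV]; exists A => // y.
have [|x Ax Vxy] := AV _ (j y) I; first by split.
by exists x => //; exact: (VE (x, y)).
Qed.

(** * Extension of uniformly continuous maps and uniqueness of completions *)

Section extension.
Context {X : Type} {Y Z : uniformType} (j : X -> Y) (k : X -> Z).
Hypotheses (dj : dense (range j)) (cZ : complete_space Z)
  (hZ : hausdorff_space Z).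
Hypothesis jk : forall E, entourage E -> exists2 V, entourage V &
  forall x x', V (j x, j x') -> E (k x, k x').

(** Density makes this filter proper; the limit of its image under [k] is the value of the extension
    at [y]. *)
Let trace (y : Y) : set_system X := filter_from (nbhs y) (fun A => j @^-1` A).

Let trace_proper y : ProperFilter (trace y).
Proof.
apply: filter_from_proper.
  apply: filter_from_filter; first by exists setT; exact: filterT.
  by move=> A B nA nB; exists (A `&` B) => //; exact: filterI.
by move=> A /(dense_nbhs dj)[z [Az [x _ xz]]]; exists x; rewrite /= xz.
Qed.

Let trace_cauchy y : cauchy (k @ trace y).
Proof.
move=> E /jk[V entV VE].
have entV' := entourage_invI (entourage_split_ent entV).
pose A := [set x | xsection (split_ent V `&` (split_ent V)^-1%relation) y (j x)].
have kA : (k @ trace y) (k @` A).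
  exists (xsection (split_ent V `&` (split_ent V)^-1%relation) y).
    exact: nbhs_entourage.
  by move=> x Ax; exists x.
exists (k @` A, k @` A) => // -[_ _] [/= [x Ax <-] [x' Ax' <-]].
apply: VE; move/xsectionP: Ax => [_ /= xy]; move/xsectionP: Ax' => [yx' _].
exact: (entourage_split y).
Qed.

Lemma uniform_extension : exists2 h : Y -> Z, unif_continuous h & h \o j =1 k.
Proof.
have [h hP] := choice (fun y => @cZ _ (fmap_proper_filter k (trace_proper y))
  (@trace_cauchy y)).
exists h.
  move=> E entE; set E1 := split_ent E; set E2 := split_ent E1.
  have entE1 : entourage E1 by exact: entourage_split_ent.
  have entE2 : entourage E2 by exact: entourage_split_ent.
  have [V entV VE] := jk entE2.
  set V1 := split_ent V; set V2 := split_ent V1.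
  have entV1 : entourage V1 by exact: entourage_split_ent.
  have entV2 : entourage V2 by exact: entourage_split_ent.
  (* The chain [h y], [k x], [k x'], [h y'] takes two splittings of [E], and the chain [j x], [y],
     [y'], [j x'] two splittings of [V]. *)
  have near_h y : exists x,
      [/\ V2 (y, j x), V2 (j x, y), E2 (h y, k x) & E2 (k x, h y)].
    have hE := nbhs_entourage (h y) (entourage_invI entE2).
    have [A nA Ah] := hP y _ hE.
    have nB : nbhs y (A `&` xsection (V2 `&` V2^-1%relation) y).
      exact: filterI nA (nbhs_entourage y (entourage_invI entV2)).
    have [z [[Az /xsectionP[yz zy]] [x _ xz]]] := dense_nbhs dj nB.
    rewrite -{}xz in Az yz zy.
    by have /xsectionP[hx xh] := Ah _ Az; exists x.
  apply: (filterS _ entV2) => -[y y'] /= yy'.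
  have [x [_ xy hx _]] := near_h y; have [x' [yx' _ _ hx']] := near_h y'.
  have kk : E2 (k x, k x').
    apply: VE; apply: (entourage_split y) => //.
      by apply: split_ent_subset.
    by apply: (entourage_split y').
  apply: (entourage_split (k x')) => //.
    by apply: (entourage_split (k x)).
  by apply: split_ent_subset.
move=> x; have FF := trace_proper (j x).
apply: (cvg_unique hZ (hP (j x))) => /=.
apply/cvg_app_entourageP => E /jk[V entV VE].
exists (xsection V (j x)); first exact: nbhs_entourage.
by move=> x' /xsectionP; exact: VE.
Qed.

End extension.

(** Both maps induce the uniformity of [X], so each extends along the other; the composites agree
    with the identity on dense ranges, hence everywhere. *)
Lemma completion_unique (X Y Z : uniformType) (j : X -> Y) (k : X -> Z) :
  is_completion j -> is_completion k ->
  exists2 h : Y -> Z, unif_isomorphism h & h \o j =1 k.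
Proof.
move=> [cY hY dj ej] [cZ hZ dk ek].
have compat (U V : uniformType) (f : X -> U) (g : X -> V) :
    @entourage (initial_topology f) = @entourage X ->
    @entourage (initial_topology g) = @entourage X ->
    forall E, entourage E -> exists2 W, entourage W &
      forall x x', W (f x, f x') -> E (g x, g x').
  move=> ef eg E entE.
  have : @entourage (initial_topology g) [set p | E (g p.1, g p.2)] by exists E.
  by rewrite eg -ef => -[W entW WE]; exists W => // x x' /(WE (x, x')).
have [h uh hj] := uniform_extension dj cZ hZ (compat _ _ _ _ ej ek).
have [l ul lk] := uniform_extension dk cY hY (compat _ _ _ _ ek ej).
exists h => //; exists l; split=> //.
- apply: (continuous_dense_eq (g := id) hY dj) => [y|y|y].
  + apply: continuous_comp; exact: unif_continuous_continuous.
  + exact: cvg_id.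
  + by rewrite inE => -[x _ <-]; move: (hj x) (lk x) => /= -> ->.
- apply: (continuous_dense_eq (g := id) hZ dk) => [z|z|z].
  + apply: continuous_comp; exact: unif_continuous_continuous.
  + exact: cvg_id.
  + by rewrite inE => -[x _ <-]; move: (hj x) (lk x) => /= + -> => ->.
Qed.

(** * Finite pseudo-metrics in a Urysohn space; homogeneity for indexed families *)

Section pseudometric_extension.
Context {R : realType} (M : metricType R) (uryM : urysohn M).

Section quotient.
Context {I : finType} (D : I -> I -> R).
Hypotheses (D_refl : forall i, D i i = 0) (D_sym : forall i j, D i j = D j i)
  (D_triangle : forall j i k, D i k <= D i j + D j k).

(** Chooses one point in the class of [i] under [D i j = 0]. The default [i] is never taken, as
    [D i i = 0], so the result depends on the class only. *)
Let rep (i : I) : I := odflt i [pick j | D i j == 0].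

Let D_ge0 i j : 0 <= D i j.
Proof.
by have := D_triangle j i i; rewrite D_refl (D_sym j i); lra.
Qed.

Let D_rep i : D i (rep i) = 0.
Proof. by rewrite /rep; case: pickP => //= j /eqP. Qed.

Let D_rep2 i j : D (rep i) (rep j) = D i j.
Proof.
have ri := D_rep i; have rj := D_rep j.
have := D_triangle i (rep i) (rep j); have := D_triangle j i (rep j).
have := D_triangle (rep i) i j; have := D_triangle (rep j) (rep i) j.
rewrite (D_sym (rep i) i) (D_sym (rep j) j) => *.
by apply/eqP; rewrite eq_le; lra.
Qed.

Let rep_eq i j : D i j = 0 -> rep i = rep j.
Proof.
move=> ij0.
have -> : rep j = odflt j [pick k | D i k == 0].
  congr odflt; apply: eq_pick => k.
  have := D_triangle i j k; have := D_triangle j i k.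
  rewrite (D_sym j i) ij0 => *; congr (_ == 0).
  by apply/eqP; rewrite eq_le; lra.
by rewrite /rep; case: pickP => // /(_ i); rewrite D_refl eqxx.
Qed.

Let rep_idem i : rep (rep i) == rep i.
Proof. by apply/eqP/rep_eq; rewrite D_sym. Qed.

Let L : finType := {i : I | rep i == i}.

Let LD (u v : L) : R := D (val u) (val v).

Let LD_positivity (u v : L) : LD u v = 0 -> u = v.
Proof.
move=> /rep_eq uv; apply: val_inj.
by rewrite -(eqP (valP u)) -(eqP (valP v)).
Qed.

Let metricL : metricType R := HB.pack_for (metricType R) L
  (@isMetric.Build R L LD (fun u => D_refl (val u)) LD_positivity
     (fun u v => D_sym (val u) (val v))
     (fun v u w => D_triangle (val v) (val u) (val w))).

(* The Urysohn property is stated for metric spaces; identifying points at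
   distance zero extends it to pseudo-metrics. *)
Lemma urysohn_pseudometric (K : pred I) (f : I -> M) :
  (forall i j, D i j <= 1) ->
  {in K &, forall i j, mdist (f i) (f j) = D i j} ->
  exists2 g : I -> M, (forall i j, mdist (g i) (g j) = D i j) & {in K, g =1 f}.
Proof.
move=> D_le1 fK; case: uryM => _ ext.
(* [rK u] selects a member of [K] in the class [u], where [f'] evaluates [f]. The choice is
   immaterial: [f] is isometric on [K], hence equal at members of one class. *)
pose rK (u : L) := [pick i in K | rep i == val u].
pose f' (u : metricL) : M := f (odflt (val (u : L)) (rK u)).
pose K' : set metricL := [set u | rK u].
have rKP (u : L) i : rK u = Some i -> i \in K /\ D i (val u) = 0.
  rewrite /rK; case: pickP => // k /andP[kK /eqP ku] [<-]; split=> //.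
  by rewrite -ku.
have [||u v|g gd gf] := ext metricL K' f'.
- exact: (@finite_finset L).
- by apply: ge_ereal_sup => _ [[u v] _ <-]; rewrite lee_fin; exact: D_le1.
- rewrite !inE /K' /f' /=.
  case: (rK u) (rKP u) => //= i /(_ _ erefl)[iK iu] _.
  case: (rK v) (rKP v) => //= j /(_ _ erefl)[jK jv] _.
  by rewrite fK // -D_rep2 (rep_eq iu) (rep_eq jv) D_rep2.
pose p i : metricL := (exist _ (rep i) (rep_idem i) : L).
exists (fun i => g (p i)) => [i j|i iK].
  rewrite gd ?inE //; exact: D_rep2.
have : rK (p i).
  by rewrite /rK; case: pickP => //= /(_ i); rewrite iK eqxx.
move=> rKi; rewrite gf ?inE // /f'.
case: (rK (p i)) (rKP (p i)) rKi => //= k /(_ _ erefl)[kK ki] _.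
by apply: mdist_positivity; rewrite fK // -D_rep2 (rep_eq ki) D_rep2 /= D_sym.
Qed.

End quotient.

End pseudometric_extension.

(** The family [b] may repeat values; equal distances force [b'] to repeat them too, so sending
    [b j] to [b' j] is well defined. *)
Lemma homogeneous_family (R : realType) (M : metricType R) (J : finType)
    (b b' : J -> M) : omega_homogeneous M ->
  (forall i j, mdist (b i) (b j) = mdist (b' i) (b' j)) ->
  exists phi : Iso M, forall j, phi (b j) = b' j.
Proof.
move=> homM bb'.
pose f x := if [pick j | b j == x] is Some j then b' j else x.
have fb j : f (b j) = b' j.
  rewrite /f; case: pickP => [k /eqP kj|/(_ j)]; last by rewrite eqxx.
  by apply: mdist_positivity; rewrite -bb' kj mdistxx.
have [||||phi phif] := homM (range b) (f @` range b) f.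
- exact/finite_image/finite_finset.
- exact/finite_image/finite_image/finite_finset.
- by move=> x y; rewrite !inE => -[i _ <-] [j _ <-]; rewrite !fb bb'.
- by [].
by exists phi => j; rewrite phif ?fb // inE; exists j.
Qed.

(** * Isometries with prescribed or approximate values on finite families *)

Section configurations.
Context {R : realType} (M : metricType R).
Hypotheses (homM : omega_homogeneous M) (uryM : urysohn M).

(** The bounds on [c] are the mixed triangle inequalities on two copies of [J], with [c] as the
    cross distance. Embedding over [a] produces a copy of [b], onto which homogeneity moves [b]. *)
Lemma iso_prescribed_distances (J : finType) (a b : J -> M) (c : J -> J -> R) :
  (forall i j, c i j <= 1) ->
  (forall i j k, `|c i j - c i k| <= mdist (b j) (b k) <= c i j + c i k) ->
  (forall i j k, `|c j i - c k i| <= mdist (a j) (a k) <= c j i + c k i) ->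
  exists phi : Iso M, forall i j, mdist (a i) (phi (b j)) = c i j.
Proof.
move=> c_le1 cb ca.
pose D (u v : J + J) : R := match u, v with
  | inl i, inl j => mdist (a i) (a j)
  | inr i, inr j => mdist (b i) (b j)
  | inl i, inr j | inr j, inl i => c i j
  end.
have dM := mdist_le1 (urysohn_diameter uryM).
pose f (u : J + J) := match u with inl i => a i | inr i => b i end.
have [|||||g gD gK] := @urysohn_pseudometric R M uryM _ D _ _ _
    (fun u => if u is inl _ then true else false) f.
- by move=> [i|i] /=; rewrite mdistxx.
- by move=> [i|i] [j|j] //=; rewrite metric_sym.
- move=> [j|j] [i|i] [k|k] //=; try exact: metric_triangle.
  + by have := ca k i j; rewrite ler_norml; lra.
  + by have := ca i j k; rewrite ler_norml; lra.
  + by have /andP[_] := cb j i k.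
  + by have /andP[_] := ca j i k.
  + by have := cb i j k; rewrite ler_norml; lra.
  + by have := cb k i j; rewrite ler_norml; lra.
- by move=> [i|i] [j|j] /=.
- by move=> [i|i] [j|j] //= _ _.
have [phi phib] := homogeneous_family homM
  (fun i j => esym (gD (inr i) (inr j)) : mdist (b i) (b j) = _).
exists phi => i j; have gi : g (inl i) = a i by exact: gK.
by rewrite phib -gi gD.
Qed.

(* The shortest path distance from [a i] to [b j], cut off at 1, when every
   [a k] is joined to [b k] by an edge of length [e]. *)
Let bridge (J : finType) (a b : J -> M) (e : R) (i j : J) : R :=
  \big[Order.min/1]_k (mdist (a i) (a k) + e + mdist (b k) (b j)).

Let bridge_sym (J : finType) (a b : J -> M) (e : R) i j :
  bridge a b e i j = bridge b a e j i.
Proof.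
apply: eq_bigr => k _.
by rewrite (metric_sym (a i)) (metric_sym (b k)) addrC (addrC _ e) addrA.
Qed.

(** The Lipschitz bound is the triangle inequality at the end of a path. For the sum, paths through
    [l] and [m] cross two bridges of total length 2e, which pays for the gap between d(a l, a m) and
    d(b l, b m). *)
Let bridge_katetov (J : finType) (a b : J -> M) (e : R) : 0 < e ->
  (forall i j, `|mdist (a i) (a j) - mdist (b i) (b j)| <= e *+ 2) ->
  forall i j k, `|bridge a b e i j - bridge a b e i k| <= mdist (b j) (b k)
    <= bridge a b e i j + bridge a b e i k.
Proof.
move=> e0 ab i j k; have dM := mdist_le1 (urysohn_diameter uryM).
pose path j l := mdist (a i) (a l) + e + mdist (b l) (b j).
set c := bridge a b e i; rewrite -/(c j) -/(c k).
have c_le1 s : c s <= 1 by exact: bigmin_le_id.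
have c_le s l : c s <= path s l by exact: bigmin_le.
have le_c x s : x <= 1 -> (forall l, x <= path s l) -> x <= c s.
  by move=> x1 xl; apply: le_bigmin => // l _; exact: xl.
have path_ge0 s l : 0 <= path s l.
  by rewrite /path !addr_ge0 ?mdist_ge0 // ltW.
have c_ge0 s : 0 <= c s by apply: (le_c) => [|l]; [exact: ler01|exact: path_ge0].
have lip s t : c s - mdist (b t) (b s) <= c t.
  apply: (le_c) => [|l].
    by have := c_le1 s; have := mdist_ge0 (b t) (b s); lra.
  have := c_le s l; have := metric_triangle (b l) (b t) (b s).
  by rewrite /path; lra.
have jk := lip j k; have kj := lip k j; rewrite (metric_sym (b k)) in jk.
rewrite ler_norml; apply/andP; split; first by lra.
(* Minimize over the path [l] to [b j], then over the path [m] to [b k]; the diameter bound handles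
   the cutoff at 1. *)
rewrite -lerBlDr; apply: (le_c) => [|l].
  by have := dM (b j) (b k); have := c_ge0 k; lra.
suff : mdist (b j) (b k) - path j l <= c k by lra.
apply: (le_c) => [|m].
  by have := dM (b j) (b k); have := path_ge0 j l; lra.
have := ab l m; rewrite ler_norml /path mulr2n.
have := metric_triangle (b j) (b l) (b k).
have := metric_triangle (b l) (b m) (b k).
have := metric_triangle (a l) (a i) (a m).
by rewrite (metric_sym (b j) (b l)) (metric_sym (a l) (a i)); lra.
Qed.

Lemma iso_close_configurations (J : finType) (a b : J -> M) (e : R) : 0 < e ->
  (forall i j, `|mdist (a i) (a j) - mdist (b i) (b j)| <= e *+ 2) ->
  exists phi : Iso M, forall i, mdist (a i) (phi (b i)) <= e.
Proof.
move=> e0 ab.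
have ba i j : `|mdist (b i) (b j) - mdist (a i) (a j)| <= e *+ 2.
  by rewrite distrC.
have [i j|i j k|phi phiE] := @iso_prescribed_distances J a b (bridge a b e) _
    (bridge_katetov e0 ab).
- exact: bigmin_le_id.
- by rewrite !(bridge_sym a b); exact: bridge_katetov.
(* The path consisting of the edge at [i] alone has length [e]. *)
exists phi => i; rewrite phiE; apply: le_trans (bigmin_le _ i _) _.
by rewrite !mdistxx add0r addr0.
Qed.

End configurations.

(** * Topology, uniformity and compactness of [Theta] *)

Section Theta_topology.
Context {R : realType} (M : metricType R).

Lemma nbhs_Theta (f : Theta M) (A : set (Theta M)) : nbhs f A <->
  exists2 B : set {ptws M * M -> R}, nbhs (val f : {ptws M * M -> R}) B &
    val @^-1` B `<=` A.
Proof.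
split.
  by move=> [_ [[B oB <-] Bf] /= BA]; exists B => //; exact: open_nbhs_nbhs.
move=> [B nB BA]; apply: filterS BA _.
exact: (@initial_continuous _ _ (val : Theta M -> {ptws M * M -> R})).
Qed.

Lemma cvg_Theta (F : set_system (Theta M)) (f : Theta M) : Filter F ->
  (forall p (e : R), 0 < e -> F [set g | `|val f p - val g p| < e]) -> F --> f.
Proof.
move=> FF Ff A /nbhs_Theta[B nB BA]; apply: filterS BA _.
have : (val @ F : set_system {ptws M * M -> R}) --> (val f : {ptws M * M -> R}).
  apply/cvg_sup => p U [_ [[C oC <-] Cf] /= CU].
  apply: filterS CU _.
  have /nbhs_ballP[e e0 eC] : nbhs (val f p) C by apply: open_nbhs_nbhs.
  rewrite nbhs_filterE /=; apply: filterS (Ff p e e0) => g fg.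
  exact: eC.
exact.
Qed.

Lemma entourage_Theta (p : M * M) (e : R) : 0 < e ->
  entourage [set fg : Theta M * Theta M | `|val fg.1 p - val fg.2 p| < e].
Proof.
move=> e0; pose T := {ptws M * M -> R}.
exists [set fg : T * T | `|fg.1 p - fg.2 p| < e]; last by [].
pose V : set (T * T) := [set fg | `|fg.1 p - fg.2 p| < e].
have entV : `[< @entourage (initial_topology (fun f : T => f p)) V >].
  apply/asboolP; exists [set xy : R * R | `|xy.1 - xy.2| < e] => //.
  by rewrite -entourage_ballE; exists e.
exists V => //.
(* [q] presents [V] as a member of the subbase of the uniformity of pointwise convergence. *)
pose q := exist (fun w : {classic M * M} * set (T * T) =>
  `[< @entourage (initial_topology (fun f : T => f w.1)) w.2 >]) (p, V) entV.
exact: (@finI_from1 _ _ _ _ q).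
Qed.

(** Every entourage contains a finite intersection of coordinate entourages. *)
Lemma entourage_Theta_sub (F : set_system (Theta M * Theta M)) : Filter F ->
  (forall p (e : R), 0 < e -> F [set fg | `|val fg.1 p - val fg.2 p| < e]) ->
  entourage `<=` F.
Proof.
move=> FF Fp E [V [W [S _ SW] WV] VE].
pose v (fg : Theta M * Theta M) := (val fg.1, val fg.2).
suff vW : (v @ F) W by apply: (@filterS _ F FF (W \o v) E) vW => fg /WV; exact: VE.
rewrite -SW; apply: filter_bigI => -[[p B] /= /asboolP[C entC CB]] _.
move: entC; rewrite -entourage_ballE => -[e /= e0 eC].
by apply: filterS (Fp p e e0) => fg fge; apply: CB; exact: eC.
Qed.

Lemma hausdorff_Theta : hausdorff_space (Theta M).
Proof.
move=> f g fg; apply: val_inj.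
apply: (@hausdorff_product _ (fun _ : M * M => R)) => [_|].
  exact: Rhausdorff.
move=> A B nA nB; have [||h [Ah Bh]] := fg (val @^-1` A) (val @^-1` B).
- by apply/nbhs_Theta; exists A.
- by apply/nbhs_Theta; exists B.
by exists (val h).
Qed.

(** Tychonoff gives a cluster point in the cube of [0,1]-valued functions. It is bi-Katetov because
    each condition involves only two values, which members of [Theta M] approximate
    simultaneously. *)
Lemma compact_Theta : compact [set: Theta M].
Proof.
move=> F PF _; pose T := {ptws M * M -> R}.
have cT : compact ([set f | forall p, `[0, 1]%classic (f p)] : set T).
  exact: (@tychonoff _ (fun=> R) (fun=> `[0, 1]%classic)
    (fun=> @segment_compact R 0 1)).
have FT : F [set f | forall p, `[0, 1]%classic (val f p)].
  apply: (filterS _ filterT) => f _ [x y]; have /set_mem[/(_ x y) + _] := valP f.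
  by rewrite /= in_itv.
have [f [f01 clf]] := cT _ (fmap_proper_filter _ PF) FT.
suff bf : f \in @bi_katetov R M.
  exists (exist _ f bf); split; first exact: I.
  move=> A B FA /nbhs_Theta[C nC CB].
  have FA' : F [set g | [set (val h : T) | h in A] (val g)].
    by apply: filterS FA => g Ag; exists g.
  have [_ [[g Ag <-] Cg]] := clf _ _ FA' nC.
  by exists g; split=> //; exact: CB.
have approx p q e : 0 < e ->
    exists g : Theta M, `|f p - val g p| < e /\ `|f q - val g q| < e.
  move=> e0.
  have nf r : nbhs (f : T) [set g : T | `|f r - g r| < e].
    exact: (@proj_continuous _ (fun=> R) r f _ (nbhsx_ballx (f r) e e0)).
  have Fr : F [set g | range (val : Theta M -> T) (val g)].
    by apply: (filterS _ filterT) => g _; exists g.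
  have [_ [[g _ <-] [gp gq]]] := clf _ _ Fr (filterI (nf p) (nf q)).
  by exists g.
have closed_cond p q d : (forall g : Theta M,
    `|val g p - val g q| <= d <= val g p + val g q) ->
    `|f p - f q| <= d <= f p + f q.
  move=> gd; suff : forall e, 0 < e -> `|f p - f q| <= d + e /\ d <= f p + f q + e.
    by move=> fe; apply/andP; split; apply/ler_addgt0Pr => e /fe[].
  move=> e e0; have e20 : 0 < e / 2 by rewrite divr_gt0.
  have [g [gp gq]] := approx p q _ e20.
  have := gd g; move: gp gq; rewrite !ltr_norml !ler_norml; lra.
apply/mem_set; split=> [x y|x y z].
  by have := f01 (x, y); rewrite /= in_itv.
by split; apply: closed_cond => g; have /set_mem[_ /(_ x y z)[]] := valP g.
Qed.

End Theta_topology.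

(** * Neighbourhoods and one-sided uniformities of the isometry group *)

Section iso_uniformities.
Context {R : realType} (M : metricType R).

Lemma iso_oneE (x : M) : iso_fun (1%g : Iso M) x = x.
Proof. by []. Qed.

Lemma iso_mulE (phi psi : Iso M) x : iso_fun (phi * psi)%g x = phi (psi x).
Proof. by []. Qed.

Lemma iso_invK (phi : Iso M) : cancel (iso_fun (phi^-1)%g) (iso_fun phi).
Proof. exact: iso_inv_funK. Qed.

Lemma nbhs_iso_dist (phi : Iso M) x (e : R) : 0 < e ->
  nbhs phi [set psi : Iso M | mdist (phi x) (psi x) < e].
Proof. by move=> e0; have /cvg_iso/(_ x _ e0) : nbhs phi --> phi by []. Qed.

(** The sets of isometries close to [phi] on a finite set generate a filter converging to [phi],
    which therefore contains every neighbourhood. *)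
Lemma nbhs_iso_finite (phi : Iso M) (U : set (Iso M)) : nbhs phi U ->
  exists s : seq M, exists2 e : R, 0 < e &
    forall psi : Iso M, {in s, forall x, mdist (phi x) (psi x) < e} -> U psi.
Proof.
move=> nU; pose F : set_system (Iso M) :=
  filter_from [set se : seq M * R | 0 < se.2]
    (fun se => [set psi : Iso M | {in se.1, forall x, mdist (phi x) (psi x) < se.2}]).
have FF : Filter F.
  apply: filter_from_filter; first by exists ([::], 1) => /=.
  move=> [s e] [t d] /= e0 d0; exists (s ++ t, Num.min e d) => /=.
    by rewrite lt_min e0.
  move=> psi /= st; split=> x xs /=; have := st x; rewrite mem_cat xs ?orbT lt_min.
    by move=> /(_ isT)/andP[].
  by move=> /(_ isT)/andP[].
have [[s e] e0 sU] : F U.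
  suff : F --> phi by apply.
  apply/(cvg_iso _ FF) => x e e0; exists ([:: x], e) => //= psi.
  by apply; rewrite inE.
by exists s, e.
Qed.

(** [phi] carries [x] and [phi^-1 (psi x)] to [phi x] and [psi x]. *)
Lemma left_uniformity_dist (x : M) (e : R) : 0 < e ->
  left_uniformity (Iso M) [set p : Iso M * Iso M | mdist (p.1 x) (p.2 x) < e].
Proof.
move=> e0; exists [set psi : Iso M | mdist ((1%g : Iso M) x) (psi x) < e].
  exact: nbhs_iso_dist.
move=> [phi psi] /=; rewrite iso_oneE iso_mulE.
by rewrite -(iso_dist phi) iso_invK.
Qed.

(** [psi] carries [phi^-1 x] and [psi^-1 x] to [psi (phi^-1 x)] and [x]. *)
Lemma right_uniformity_dist (x : M) (e : R) : 0 < e ->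
  right_uniformity (Iso M) 
    [set p : Iso M * Iso M |
       mdist (iso_fun (p.1^-1)%g x) (iso_fun (p.2^-1)%g x) < e].
Proof.
move=> e0; exists [set psi : Iso M | mdist ((1%g : Iso M) x) (psi x) < e].
  exact: nbhs_iso_dist.
move=> [phi psi] /=; rewrite iso_oneE iso_mulE.
by rewrite -(iso_dist psi (iso_fun (phi^-1)%g x)) iso_invK metric_sym.
Qed.

End iso_uniformities.

Lemma is_uniformity_entourage (T : uniformType) : is_uniformity (@entourage T).
Proof.
split; first exact: entourage_filter.
- exact: entourage_diagonal_subproof.
- exact: entourage_inv.
- exact: entourage_split_ex.
Qed.

(** * Density of the embedding and comparison with the Roelcke uniformity *)

Section embedding.
Context {R : realType} (M : metricType R).
Hypotheses (homM : omega_homogeneous M) (uryM : urysohn M).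

Let i : Iso M -> Theta M := iso_to_Theta (urysohn_diameter uryM).

Lemma dense_iso_to_Theta : dense (range i).
Proof.
move=> O [f Of] oO.
(* Isometries matching [f] exactly on pairs from [s]; they exist by [iso_prescribed_distances] with
   both families equal to [s]. *)
pose F : set_system (Iso M) := filter_from setT (fun s : seq M =>
  [set phi : Iso M | {in s &, forall x y, mdist x (phi y) = val f (x, y)}]).
have PF : ProperFilter F.
  apply: filter_from_proper.
    apply: filter_from_filter; first by exists [::].
    move=> s t _ _; exists (s ++ t) => // phi st; split=> x y xs ys /=;
      by apply: st; rewrite mem_cat ?xs ?ys ?orbT.
  move=> s _; pose a (k : 'I_(size s)) := tnth (in_tuple s) k.
  have /set_mem[f01 fK] := valP f.
  have [k l|k l m|k l m|phi phiE] := @iso_prescribed_distances R M homM uryM _ a a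
      (fun k l => val f (a k, a l)).
  - by have /andP[] := f01 (a k) (a l).
  - by have [] := fK (a k) (a l) (a m).
  - by have [] := fK (a k) (a l) (a m).
  exists phi => x y xs ys /=.
  have /tnthP[k ->] : x \in in_tuple s by [].
  have /tnthP[l ->] : y \in in_tuple s by [].
  exact: phiE.
have Ff : i @ F --> f.
  apply: cvg_Theta => -[x y] e e0; exists [:: x; y] => // phi st /=.
  by rewrite st ?inE ?eqxx ?orbT // subrr normr0.
have [phi Ophi] : i @^-1` O !=set0.
  by apply: (@filter_ex _ F); apply: Ff; exact: open_nbhs_nbhs.
by exists (i phi); split=> //; exists phi.
Qed.

(** |d(x, phi y) - d(x, psi y)| <= d(phi y, psi y). *)
Lemma initial_sub_left :
  @entourage (initial_topology i) `<=` left_uniformity (Iso M).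
Proof.
have FL := left_uniformity_filter (Iso M).
pose F : set_system (Theta M * Theta M) :=
  (fun p : Iso M * Iso M => (i p.1, i p.2)) @ left_uniformity (Iso M).
have VF : entourage `<=` F.
  apply: entourage_Theta_sub => -[x y] e e0.
  apply: (@filterS _ _ FL _ _ _ (left_uniformity_dist y e0)) => -[phi psi] /=.
  apply: le_lt_trans; have := metric_triangle x (iso_fun phi y) (iso_fun psi y).
  have := metric_triangle x (iso_fun psi y) (iso_fun phi y).
  rewrite (metric_sym (iso_fun psi y)).
  by rewrite ler_norml; lra.
by move=> A [V /VF FV VA]; exact: (@filterS _ _ FL _ _ VA).
Qed.

(** As d(x, phi y) = d(phi^-1 x, y), closeness of the inverses at [x] suffices. *)
Lemma initial_sub_right :
  @entourage (initial_topology i) `<=` right_uniformity (Iso M).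
Proof.
have FL := right_uniformity_filter (Iso M).
pose F : set_system (Theta M * Theta M) :=
  (fun p : Iso M * Iso M => (i p.1, i p.2)) @ right_uniformity (Iso M).
have VF : entourage `<=` F.
  apply: entourage_Theta_sub => -[x y] e e0.
  apply: (@filterS _ _ FL _ _ _ (right_uniformity_dist x e0)) => -[phi psi] /=.
  rewrite -[x in mdist x (iso_fun phi y)](iso_invK phi) iso_dist.
  rewrite -[x in mdist x (iso_fun psi y)](iso_invK psi) iso_dist.
  set u := iso_fun _ x; set v := iso_fun _ x.
  apply: le_lt_trans; have := metric_triangle u v y.
  have := metric_triangle v u y; rewrite (metric_sym v u).
  by rewrite ler_norml; lra.
by move=> A [V /VF FV VA]; exact: (@filterS _ _ FL _ _ VA).
Qed.

Lemma roelcke_sub_initial :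
  roelcke_uniformity (Iso M) `<=` @entourage (initial_topology i).
Proof.
move=> A [E [[_ _ _ splitE] EL ER EA]].
(* [B] leaves room for two steps, a left one through [U] and a right one through [V]. *)
have [B EB BA] := splitE _ EA.
have [U nU UB] := EL _ EB; have [V nV VB] := ER _ EB.
have [s [e e0 sUV]] := nbhs_iso_finite (filterI nU nV).
pose a (k : 'I_(size s)) := tnth (in_tuple s) k.
have sa x : x \in s -> exists k, x = a k by move=> xs; exact/tnthP.
pose D p := [set fg : Theta M * Theta M | `|val fg.1 p - val fg.2 p| < e].
exists [set fg | forall kl : 'I_(size s) * 'I_(size s), D (a kl.1, a kl.2) fg].
  apply: (@filter_forall _ _ (fun kl => D (a kl.1, a kl.2)) entourage) => kl.
  exact: entourage_Theta.
move=> [phi psi] /= close; apply: BA.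
have e20 : 0 < e / 2 by rewrite divr_gt0.
(* Only the cross distances depend on [chi], and they are values of [i chi] on [s]. Bridges of
   length [e / 2] allow distortion [e] and keep displacements below [e]. *)
pose c (chi : Iso M) (u : 'I_(size s) + 'I_(size s)) : M := match u with
  | inl k => a k
  | inr k => chi (a k)
  end.
have [|w wE] := @iso_close_configurations R M homM uryM _ (c phi) (c psi) _ e20.
  have e22 : (e / 2) *+ 2 = e by rewrite mulr2n -splitr.
  move=> [k|k] [l|l]; rewrite e22 /= ?iso_dist ?subrr ?normr0 ?(ltW e0) //.
    exact/ltW/(close (k, l)).
  rewrite (metric_sym (iso_fun phi _)) (metric_sym (iso_fun psi _)).
  exact/ltW/(close (l, k)).
have ws x : x \in s -> mdist x (w x) < e.
  by move=> /sa[k ->]; have := wE (inl k) => /=; lra.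
have wphi x : x \in s -> mdist (iso_fun phi x) (w (iso_fun psi x)) < e.
  by move=> /sa[k ->]; have := wE (inr k) => /=; lra.
(* Both phi^-1 (w psi) and psi (w psi)^-1 = w^-1 move the points of [s] by less than [e]. *)
exists (w * psi)%g.
  apply: UB; apply: (sUV (phi^-1 * (w * psi))%g _).1 => x xs.
  by rewrite iso_oneE !iso_mulE -(iso_dist phi) iso_invK; exact: wphi.
apply: VB; apply: (sUV (psi * (w * psi)^-1)%g _).2 => x xs.
rewrite invgM mulgA mulgV mul1g iso_oneE -(iso_dist w) iso_invK metric_sym.
exact: ws.
Qed.

(** The induced uniformity is coarser than both one-sided ones, hence among those whose union is the
    meet. *)
Lemma entourage_initial_iso_to_Theta :
  @entourage (initial_topology i) = roelcke_uniformity (Iso M).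
Proof.
apply/seteqP; split; last exact: roelcke_sub_initial.
move=> A entA; exists (@entourage (initial_topology i)); split=> //.
- exact: (is_uniformity_entourage (initial_topology i : uniformType)).
- exact: initial_sub_left.
- exact: initial_sub_right.
Qed.

End embedding.

Theorem theorem7p3 (R : realType) (M : metricType R)
    (complM : complete_space M) (homM : omega_homogeneous M) (uryM : urysohn M) :
  let G : topologicalGroupType := Iso M in
  let i : G -> Theta M := iso_to_Theta (urysohn_diameter uryM) in
  dense (range i) /\
  @entourage (initial_topology i) = roelcke_uniformity G /\
  roelcke_precompact G /\
  compact [set: Theta M] /\
  roelcke_compactification (i : roelcke G -> Theta M) /\
  (forall (K : uniformType) (j : roelcke G -> K), roelcke_compactification j ->
    exists2 h : K -> Theta M, unif_isomorphism h & h \o j =1 i).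
Proof.
move=> G i.
have di : dense (range i) := dense_iso_to_Theta homM uryM.
have ei : @entourage (initial_topology i) = roelcke_uniformity G :=
  entourage_initial_iso_to_Theta homM uryM.
have cT := @compact_Theta R M.
have pG : roelcke_precompact G.
  exact: (@compact_precompact_space (roelcke G) _ i).
(* Compactness makes [Theta M] complete, so [i] is a completion, to which any other is
   isomorphic. *)
have ci : is_completion (i : roelcke G -> Theta M).
  split=> //; first exact: compact_complete_space.
  exact: hausdorff_Theta.
do 5![split=> //].
by move=> K j [_ cj]; exact: completion_unique.
Qed.
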